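(* Let $k\geq1$, $2k\leq n$, $(n,k)\neq(4,2)$, $G=\operatorname{Sym}(n)$ and $H=(\operatorname{Sym}(k)\times\operatorname{Sym}(n-k))\cap\operatorname{Alt}(n)$, where $\operatorname{Sym}(k)\times\operatorname{Sym}(n-k)$ is the setwise stabilizer of $\{1,\dots,k\}$. Let $\mathcal K^+(n,k)$ be the graph on $G/H$ in which $xH\sim yH$ iff $x(\{1,\dots,k\})\cap y(\{1,\dots,k\})=\varnothing$ and $\operatorname{sgn}(x)=\operatorname{sgn}(y)$. Then the least eigenvalue of $\mathcal K^+(n,k)$ is the eigenvalue afforded by the $[n-1,1]$-module.
   Context: $H$ is a multiplicity-free subgroup of $G$ and $\chi^{[n-1,1]}$ is a constituent of $1_H^G$. The adjacency matrix of $\mathcal K^+(n,k)$ commutes with the permutation action of $G$ on $\mathbb C^{G/H}$, which is a multiplicity-free sum of irreducibles, one isomorphic to the Specht module $S^\lambda$ for each constituent $\chi^\lambda$; the scalar by which the adjacency matrix acts on that summand is the eigenvalue afforded by the $\lambda$-module. *)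

(* Defs.v *)
From HB Require Import structures.
From mathcomp Require Import all_boot all_order all_algebra.
From mathcomp Require Import all_fingroup all_solvable all_character.

Set Implicit Arguments.
Unset Strict Implicit.
Unset Printing Implicit Defensive.

Import GroupScope Order.TTheory GRing.Theory Num.Theory.
Local Open Scope ring_scope.

(* Orientation. MathComp multiplies permutations from left to right,
   (s * t) i = t (s i), and represents groups on row vectors acting on the
   right. With maps composed from right to left instead, the left coset xH is
   therefore the MathComp right coset H :* x, its translate g(xH) is
   H :* x :* g, and "rcosets H [set: gT]" is the G-set G/H. *)

Section PermutationModule.

Variables (C : fieldType) (gT : finGroupType) (G H : {group gT}).

Definition coset_vec (X : {set gT}) : 'rV[C]_#|rcosets H G| :=
  \row_j (enum_val j == X)%:R.

Definition coset_mx (g : gT) : 'M[C]_#|rcosets H G| :=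
  \matrix_(i, j) (enum_val i :* g == enum_val j)%:R.

Lemma rcosets_act (X : {set gT}) g :
  X \in rcosets H G -> g \in G -> X :* g \in rcosets H G.
Proof.
case/rcosetsP=> x Gx -> Gg; rewrite -rcosetM.
by apply/rcosetsP; exists (x * g)%g; rewrite ?groupM.
Qed.

Lemma coset_vec_mx (X : {set gT}) g :
  X \in rcosets H G -> coset_vec X *m coset_mx g = coset_vec (X :* g).
Proof.
move=> GX; apply/rowP=> j; rewrite !mxE (bigD1 (enum_rank_in GX X)) //=.
rewrite !mxE enum_rankK_in // eqxx mul1r eq_sym big1 ?addr0 // => i neq_i.
rewrite !mxE; case: eqP => [eqX | _]; last by rewrite mul0r.
by case/eqP: neq_i; apply: enum_val_inj; rewrite enum_rankK_in.
Qed.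

Lemma coset_mx_repr : mx_repr G coset_mx.
Proof.
have rowE i g : row i (coset_mx g) = coset_vec (enum_val i :* g).
  by apply/rowP=> j; rewrite !mxE eq_sym.
split=> [|g h Gg Gh].
  apply/row_matrixP=> i; rewrite rowE rcoset1; apply/rowP=> j.
  by rewrite !mxE (inj_eq enum_val_inj) eq_sym.
apply/row_matrixP=> i; rewrite row_mul !rowE coset_vec_mx ?rcosetM //.
by rewrite rcosets_act ?enum_valP.
Qed.

Canonical coset_repr := MxRepresentation coset_mx_repr.

End PermutationModule.

Section Specht.

Variables (C : fieldType) (n : nat) (la : seq nat).

(* la is meant to be a partition of n. The reference tableau of shape la is
   filled with 0, ..., n - 1 row after row, so that entry i lies in row
   "reshape_index la i" and column "reshape_offset la i". A permutation s
   stands for the tableau obtained by applying s to all its entries. *)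
Definition row_stab : {group 'S_n} :=
  (\bigcap_(r < size la) 'N([set i : 'I_n | reshape_index la i == r] | 'P))%G.

Definition col_stab : {group 'S_n} :=
  (\bigcap_(c < n) 'N([set i : 'I_n | reshape_offset la i == c] | 'P))%G.

(* The tabloid of the tableau s is the coset "row_stab :* s", so that the
   permutation module on tabloids is the following one. *)
Definition tabloid_repr := coset_repr C [set: 'S_n] row_stab.

(* The column stabilizer of the tableau s is "col_stab :^ s", and letting
   t ^ s act on the tabloid of s gives the tabloid of t * s. *)
Definition polytabloid (s : 'S_n) : 'rV[C]_#|rcosets row_stab [set: 'S_n]| :=
  \sum_(t in col_stab)
     (-1) ^+ t *: coset_vec C [set: 'S_n] row_stab (row_stab :* (t * s)).

Definition specht_mx : 'M[C]_#|rcosets row_stab [set: 'S_n]| :=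
  (\sum_(s : 'S_n) <<polytabloid s>>)%MS.

Lemma specht_module : mxmodule tabloid_repr specht_mx.
Proof.
apply/mxmoduleP=> g _; rewrite sumsmxMr; apply/sumsmx_subP=> s _.
apply: (sumsmx_sup (s * g)%g) => //.
rewrite (eqmxMr _ (genmxE _)) genmxE mulmx_suml.
suff -> : polytabloid (s * g) =
  \sum_(t in col_stab) (-1) ^+ t *:
    coset_vec C [set: 'S_n] row_stab (row_stab :* (t * s)) *m tabloid_repr g
  by [].
apply: eq_bigr => t _; rewrite -scalemxAl coset_vec_mx ?mulgA ?rcosetM //.
by rewrite -!rcosetM; apply/rcosetsP; exists (t * s)%g; rewrite ?inE.
Qed.

Definition specht_repr := submod_repr specht_module.

End Specht.

Section Graph.

Definition adj_mx (C : pzRingType) (T : finType) (V : {set T}) (e : rel T) :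
    'M[C]_#|V| :=
  \matrix_(i, j) (e (enum_val i) (enum_val j))%:R.

Definition least_eigenvalue (C : numClosedFieldType) m (A : 'M[C]_m) (a : C) :=
  eigenvalue A a /\ forall b, eigenvalue A b -> a <= b.

(* Existence of a submodule isomorphic to S^la is part of the definition, and
   the matrix A must act by the same scalar on all of them; in a
   multiplicity-free module there is only one. *)
Definition afforded_eigenvalue (C : fieldType) n (H : {group 'S_n})
    (A : 'M[C]_#|rcosets H [set: 'S_n]|) (la : seq nat) (a : C) :=
  let rG := coset_repr C [set: 'S_n] H in
  (exists (U : 'M[C]_#|rcosets H [set: 'S_n]|) (modU : mxmodule rG U),
      mx_rsim (submod_repr modU) (specht_repr C n la)) /\
  (forall (U : 'M[C]_#|rcosets H [set: 'S_n]|) (modU : mxmodule rG U),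
      mx_rsim (submod_repr modU) (specht_repr C n la) -> U *m A = a *: U).

Variables n k : nat.

Definition first_points : {set 'I_n} := [set i : 'I_n | (i < k)%N].

Definition even_young : {group 'S_n} :=
  ('N(first_points | 'P) :&: 'Alt_('I_n))%G.

Definition kneser_plus : rel {set 'S_n} := fun X Y =>
  [exists x in X, exists y in Y,
     [disjoint x @: first_points & y @: first_points]
     && (odd_perm x == odd_perm y)].

Lemma kneser_plusE (x y : 'S_n) :
  kneser_plus (even_young :* x) (even_young :* y) =
  [disjoint x @: first_points & y @: first_points]
  && (odd_perm x == odd_perm y).
Proof.
have cosetE (h z : 'S_n) : h \in even_young ->
    ((h * z)%g @: first_points = z @: first_points)
    * (odd_perm (h * z)%g = odd_perm z).
  case/setIP=> Nh; rewrite Alt_even odd_permM => /negbTE->; split=> //.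
  rewrite -[in RHS](astabs_setact Nh) /setact -imset_comp.
  by apply: eq_imset => i; rewrite /= /aperm permM.
apply/exists_inP/idP=> [[_ /rcosetP[h Hh ->]]|adj_xy].
  case/exists_inP=> _ /rcosetP[h' Hh' ->].
  by rewrite !(cosetE _ _ Hh) !(cosetE _ _ Hh').
by exists x; rewrite ?rcoset_refl //; apply/exists_inP; exists y;
   rewrite ?rcoset_refl.
Qed.

Definition kneser_plus_mx (C : pzRingType) :
    'M[C]_#|rcosets even_young [set: 'S_n]| :=
  adj_mx C (rcosets even_young [set: 'S_n]) kneser_plus.

End Graph.

(* Main.v *)
Require Import Defs.
From mathcomp Require Import all_boot all_order all_algebra.
From mathcomp Require Import all_fingroup all_solvable all_character.
From mathcomp Require Import zify.

Set Implicit Arguments.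
Unset Strict Implicit.
Unset Printing Implicit Defensive.

Import GroupScope Order.TTheory GRing.Theory Num.Theory.

(* For n >= 3, xH |-> (x{1..k}, sgn x) identifies G/H with the pairs (B, e),
   |B| = k, so that K^+(n,k) is two disjoint copies of the Kneser graph.

   If f is an eigenfunction of the Kneser graph for b and F(I) is the sum of f
   over the k-sets containing I, then double counting and inclusion-exclusion
   give, for i = |I|,
     b F(I) = C(n-k-i, k-i) * sum over J subset of I of (-1)^|J| F(J),
   and a minimal I with F(I) != 0 yields b = (-1)^i C(n-k-i, k-i). The least of
   these numbers is theta = - C(n-k-1, k-1), for i = 1.

   The Specht module is spanned by the differences e_p - e_q of tabloids. If phi
   intertwines it with C^(G/H), then the vectors h_p = phi(n e_p - sum_q e_q)
   are permuted by G and add up to 0. Outside of (n,k) = (3,1) this forces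
   h_p(B, e) to depend only on whether p is in B, whence h_p A = theta h_p.
   Conversely, the point-coset incidence matrix embeds the Specht module. *)

(** * Counting k-sets and the eigenvalues of the Kneser graph *)

Section Subsets.
Local Open Scope ring_scope.
Variables (T : finType) (k : nat).

(** Removing [I] from [D] leaves an arbitrary subset of size [k - #|I|] of the complement of
    [I :|: B]. *)
Lemma card_draws_between (I B : {set T}) :
  [disjoint I & B] -> (#|I| <= k)%N ->
  #|[set D : {set T} | [&& #|D| == k, I \subset D & [disjoint D & B]]]|
    = 'C(#|T| - #|B| - #|I|, k - #|I|).
Proof.
move=> dIB leIk; pose Z := ~: (I :|: B).
have cardZ : #|Z| = (#|T| - #|B| - #|I|)%N.
  rewrite cardsCs setCK cardsU (disjoint_setI0 dIB) cards0 subn0; lia.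
rewrite -cardZ -cards_draws.
have injU : {in [set D : {set T} | D \subset Z & #|D| == (k - #|I|)%N] &,
               injective (fun D => I :|: D)}.
  move=> D E; rewrite !inE => /andP[DZ _] /andP[EZ _] eqDE.
  have sdiff (X : {set T}) : X \subset Z -> (I :|: X) :\: I = X.
    move=> /subsetP XZ; apply/setP=> x; rewrite !inE.
    have [/XZ|] := boolP (x \in X); rewrite ?inE; last by case: (x \in I).
    by rewrite negb_or; case: (x \in I).
  by rewrite -(sdiff D) // eqDE sdiff.
rewrite -(card_in_imset injU); apply: eq_card => D; rewrite inE.
apply/and3P/imsetP=> [[/eqP cD sID dDB]|[E]].
  exists (D :\: I).
    rewrite inE cardsD (setIidPr sID) cD eqxx andbT; apply/subsetP=> x.
    by rewrite !inE negb_or => /andP[-> /(disjointFr dDB)->].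
  by rewrite setUC setDE setUIl setUC [~: I :|: I]setUC setUCr setIT (setUidPr
    sID).
rewrite inE => /andP[/subsetP EZ /eqP cE] ->.
have dIE : I :&: E = set0.
  apply/setP=> x; rewrite !inE; apply/negP=> /andP[Ix /EZ].
  by rewrite !inE Ix.
split; first by rewrite cardsU dIE cards0 cE subn0 subnKC.
  exact: subsetUl.
rewrite disjoint_subset; apply/subsetP=> x; rewrite !inE => /orP[Ix|/EZ].
  by rewrite (disjointFr dIB Ix).
by rewrite !inE negb_or => /andP[_].
Qed.

Lemma sum_disjoint_signed (R : comRingType) (f : {set T} -> R) (I : {set T}) :
  \sum_(B : {set T} | (#|B| == k) && [disjoint I & B]) f B =
  \sum_(J : {set T} | J \subset I)
     (-1) ^+ #|J| * \sum_(B : {set T} | (#|B| == k) && (J \subset B)) f B.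
Proof.
have incl_excl (B : {set T}) :
    \sum_(J : {set T} | J \subset I) (-1) ^+ #|J| * (J \subset B)%:R
      = [disjoint I & B]%:R :> R.
  (* Expanding this product, [J] collects the points where the first summand is chosen; only subsets
     of both [I] and [B] contribute. *)
  transitivity (\prod_(x : T) ((x \in I)%:R * - (x \in B)%:R + 1 : R)).
    rewrite bigA_distr /= big_mkcond; apply: eq_bigr => J _.
    rewrite -big_mkcond /=.
    have [JI|/subsetPn[x Jx /negbTE nIx]] := boolP (J \subset I); last first.
      by rewrite (bigD1 x) //= nIx mul0r mul0r.
    have [JB|/subsetPn[x Jx /negbTE nBx]] := boolP (J \subset B); last first.
      by rewrite mulr0 (bigD1 x) //= nBx oppr0 mulr0 mul0r.
    rewrite mulr1 (eq_bigr (fun=> -1)) ?prodr_const // => x Jx.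
    by rewrite (subsetP JI x Jx) (subsetP JB x Jx) mul1r.
  have [dIB|/pred0Pn[x /= /andP[Ix Bx]]] := boolP [disjoint I & B].
    rewrite big1 // => x _; have [Ix|_] := boolP (x \in I);
      last by rewrite mul0r add0r.
    by rewrite (disjointFr dIB Ix) oppr0 mulr0 add0r.
  by rewrite (bigD1 x) //= Ix Bx mul1r addNr mul0r.
rewrite big_mkcondr /= (eq_bigr (fun B : {set T} =>
  \sum_(J : {set T} | J \subset I) (-1) ^+ #|J| * (J \subset B)%:R * f B)).
  rewrite exchange_big /=; apply: eq_bigr => J _.
  rewrite mulr_sumr [RHS]big_mkcondr /=; apply: eq_bigr => B _.
  by case: (J \subset B); rewrite ?mulr1 // mulr0 mul0r.
by move=> B _; rewrite -mulr_suml incl_excl; case: [disjoint _ & _];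
  rewrite ?mul1r ?mul0r.
Qed.

Lemma kneser_eigenvalue (R : idomainType) (f : {set T} -> R) (b : R)
    (B0 : {set T}) :
  #|B0| = k -> f B0 != 0 ->
  (forall B : {set T}, #|B| = k ->
     \sum_(D : {set T} | (#|D| == k) && [disjoint D & B]) f D = b * f B) ->
  exists2 i, (i <= k)%N & b = (-1) ^+ i * 'C(#|T| - k - i, k - i)%:R.
Proof.
move=> cB0 fB0 fE.
pose F (I : {set T}) := \sum_(B : {set T} | (#|B| == k) && (I \subset B)) f B.
(* The minimum is over a nonempty family, since [F B0 = f B0]. *)
have [|I] := @arg_minnP {set T} B0
    (fun I => (#|I| <= k)%N && (F I != 0)) (fun I => #|I|).
  rewrite cB0 leqnn /F (big_pred1 B0) // => B /=; apply/andP/eqP => [|->].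
    by move=> [/eqP cB sB]; apply/esym/eqP; rewrite eqEcard sB cB cB0 /=.
  by rewrite cB0.
move=> /andP[leIk FI] minI; exists #|I| => //.
have disjI : \sum_(B : {set T} | (#|B| == k) && [disjoint I & B]) f B
      = (-1) ^+ #|I| * F I.
  (* By minimality [F] vanishes on the proper subsets of [I], so only [J = I] survives. *)
  rewrite sum_disjoint_signed (bigD1 I) //= [X in _ + X = _]big1 ?addr0 // => J
    /andP[JI neqJI].
  have ltJI : (#|J| < #|I|)%N by rewrite proper_card // properEneq neqJI.
  have [FJ|FJ] := eqVneq (F J) 0; first by rewrite -/(F J) FJ mulr0.
  by have := minI J; rewrite FJ andbT; move: ltJI leIk; lia.
(* Sum the eigenvalue equation over the k-sets [B] containing [I]. After the exchange, each [D]
   disjoint from [I] is counted once for every such [B] disjoint from [D], and a [D] meeting [I] is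
   never counted. *)
apply: (mulIf FI); rewrite mulrAC -disjI mulr_sumr.
rewrite (eq_bigr (fun B : {set T} =>
  \sum_(D : {set T} | (#|D| == k) && [disjoint D & B]) f D)); last first.
  by move=> B /andP[/eqP cB _]; rewrite fE.
rewrite (exchange_big_dep (fun D : {set T} => #|D| == k)) /=;
  last by move=> B D _ /andP[].
rewrite mulr_suml [RHS]big_mkcondr /=; apply: eq_bigr => D /eqP cD.
rewrite sumr_const.
have [dID|dID] := ifP.
  rewrite mulr_natr; have := card_draws_between dID leIk; rewrite cD => <-.
  congr (_ *+ _); apply: eq_card => B; rewrite !inE unfold_in /= eqxx /=.
  by rewrite [in RHS]disjoint_sym andbA.
rewrite (@eq_card0 _ _) // => B; rewrite unfold_in /=; apply/negP.
by case/and3P=> /andP[_ IB] _ /(disjointWr IB); rewrite disjoint_sym dID.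
Qed.

End Subsets.

(** * The smallest of the Kneser eigenvalues *)

Section KneserBound.
Local Open Scope ring_scope.

(** Even [i] give nonnegative values. For odd [i] the binomial decreases with [i] by Pascal's rule,
    so [i = 1] gives the largest absolute value. *)
Lemma kneser_eigenvalue_ge (R : numDomainType) n k i : (0 < k)%N ->
  (k + k <= n)%N ->
  (i <= k)%N ->
  - 'C(n - k - 1, k - 1)%:R <= (-1) ^+ i * 'C(n - k - i, k - i)%:R :> R.
Proof.
move=> k_gt0 le2kn; rewrite -signr_odd.
have pos j : 0 <= 'C(n - k - j, k - j)%:R :> R by rewrite ler0n.
case: (boolP (odd i)) => [odd_i lik|_ _]; last first.
  by rewrite expr0 mul1r (le_trans _ (pos _)) // oppr_le0.
rewrite expr1 mulN1r lerN2 ler_nat; have : (0 < i)%N by case: i odd_i {lik}.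
elim: i lik {odd_i} => // -[|i] IHi lik _ //.
apply: leq_trans (IHi _ _); rewrite ?(ltnW lik) //.
have -> : (n - k - i.+1 = (n - k - i.+2).+1)%N by lia.
have -> : (k - i.+1 = (k - i.+2).+1)%N by lia.
by rewrite binS leq_addl.
Qed.

End KneserBound.

(** * Transitivity of the symmetric group on k-sets *)

Section PermutingSubsets.
Variable T : finType.
Implicit Types (B D : {set T}) (g : {perm T}).

Lemma tperm_imset a b B : (a \in B) = (b \in B) -> tperm a b @: B = B.
Proof.
move=> eqab; apply/eqP; rewrite eqEcard card_imset ?leqnn ?andbT;
  last exact: perm_inj.
apply/subsetP=> _ /imsetP[x Bx ->].
by case: tpermP Bx => [->|->|//]; rewrite eqab.
Qed.

(** Take [g] with the fewest points of [g @: B] outside [D]. If one is left, swapping it with a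
    point of [D] outside [g @: B] does better. *)
Lemma exists_perm_imset B D : #|B| = #|D| -> exists g : {perm T}, g @: B = D.
Proof.
move=> eqBD.
have [//|g _ ming] := @arg_minnP _ (1%g : {perm T}) xpredT (fun g => #|g @: B
  :\: D|).
have cg : #|g @: B| = #|D| by rewrite card_imset //; exact: perm_inj.
have [sBD|/subsetPn[x Bx nDx]] := boolP (g @: B \subset D).
  by exists g; apply/eqP; rewrite eqEcard sBD cg /=.
have [y Dy nBy] : exists2 y, y \in D & y \notin g @: B.
  apply/subsetPn; apply: contra nDx => sDB.
  have/eqP E : D == g @: B by rewrite eqEcard sDB cg leqnn.
  by rewrite E.
have := ming (g * tperm x y)%g isT; rewrite leqNgt => /negP[].
apply/proper_card/properP; split.
  apply/subsetP=> z; rewrite !inE => /andP[nDz /imsetP[w Bw def_z]].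
  rewrite nDz def_z permM; move: nDz; rewrite def_z permM.
  by case: tpermP => [_|_|_ _ _] /=; rewrite ?Dy ?imset_f.
exists x; rewrite !inE nDx ?Bx //=; apply/imsetP=> -[w Bw].
rewrite permM; case: tpermP => [_ eqxy|eqy _|neqx _ eqx]; last by case: neqx.
  by rewrite -eqxy Bx in nBy.
by case/negP: nBy; rewrite -eqy imset_f.
Qed.

Lemma exists_perm_imset_point B D p q :
    #|B| = #|D| -> (p \in B) = (q \in D) ->
      exists2 g : {perm T}, g @: B = D & g p = q.
Proof.
move=> /exists_perm_imset[g gB] eqpq.
(* [g p] and [q] are both in [D] or both outside, so the correcting transposition preserves [D]. *)
exists (g * tperm (g p) q)%g; last by rewrite permM tpermL.
transitivity (tperm (g p) q @: (g @: B)).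
  by rewrite -imset_comp; apply: eq_imset => z; rewrite permM.
by rewrite gB tperm_imset // -eqpq -gB mem_imset //; apply: perm_inj.
Qed.

End PermutingSubsets.

(** * Equivariant families of functions on signed k-sets *)

Section SignedSubsets.
Local Open Scope ring_scope.
Variables (R : numDomainType) (T : finType) (k : nat).
(* psi p B e is meant to be the value of h_p at the coset (B, e). *)
Variable psi : T -> {set T} -> bool -> R.
Hypothesis k_gt0 : (0 < k)%N.
Hypothesis le_2k : (k + k <= #|T|)%N.
Hypothesis T_ge3 : (2 < #|T|)%N.
Hypothesis psi_inv : forall (g : {perm T}) p (B : {set T}) e,
  #|B| = k -> psi (g p) (g @: B) (e (+) g) = psi p B e.
Hypothesis psi_sum : forall (B : {set T}) e, #|B| = k -> \sum_p psi p B e = 0.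

(* An odd transposition fixing p and B exists unless (#|T|, k) = (3, 1). *)
Lemma psi_sign p (B : {set T}) e e' :
  #|B| = k -> (k != 1%N) || (#|T| != 3%N) -> psi p B e = psi p B e'.
Proof.
move=> cB not31.
have cC : #|~: B| = (#|T| - k)%N by rewrite cardsCs setCK cB.
suff [a [b [neq_ab neq_ap neq_bp eqB]]] :
    exists a b, [/\ a != b, a != p, b != p & (a \in B) = (b \in B)].
  suff sgn e1 : psi p B (~~ e1) = psi p B e1.
    by case: e e' => [] [] //; rewrite -sgn.
  have := psi_inv (tperm a b) p e1 cB.
  by rewrite tperm_imset // odd_tperm neq_ab tpermD // addbT.
have pick2 (X : {set T}) : p \notin X -> (1 < #|X|)%N ->
    (X \subset B) || [disjoint X & B] ->
    exists a b, [/\ a != b, a != p, b != p & (a \in B) = (b \in B)].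
  move=> nXp /card_gt1P[a [b [Xa Xb neq_ab]]] XB; exists a, b; split=> //.
  - by apply: contraNneq nXp => <-.
  - by apply: contraNneq nXp => <-.
  case/orP: XB => [/subsetP sXB|dXB]; first by rewrite !sXB.
  by rewrite !(disjointFr dXB).
have disjC (X : {set T}) : X \subset ~: B -> [disjoint X & B].
  by rewrite disjoints_subset.
(* The two points are taken outside [B] if [p] is in [B], inside [B] if [p] is not and [k > 1], and
   otherwise among the [#|T| - 2] points outside [B] and different from [p]. *)
have [Bp|nBp] := boolP (p \in B).
  apply: (pick2 (~: B)); rewrite ?inE ?Bp // ?cC; first lia.
  by rewrite disjC ?orbT.
have [k1|k1] := eqVneq k 1%N; last first.
  apply: (pick2 B); rewrite ?subxx // cB; lia.
apply: (pick2 (~: B :\ p)); rewrite ?inE ?eqxx //.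
  have := cardsD1 p (~: B); rewrite inE nBp cC; move: not31; rewrite k1 /=.
  move=> n3 eqn; rewrite -(ltn_add2l 1) -eqn; move: T_ge3 n3;
    case: #|T| => [|[|[|[|]]]] // j; lia.
by rewrite disjC ?orbT // subD1set.
Qed.

Lemma psi_const p q (B D : {set T}) e e' :
  #|B| = k -> #|D| = k -> (p \in B) = (q \in D) ->
  (k != 1%N) || (#|T| != 3%N) -> psi p B e = psi q D e'.
Proof.
move=> cB cD eqpq not31.
have [|g <- <-] := exists_perm_imset_point _ eqpq; first by rewrite cB.
by rewrite -(psi_inv g) //; apply: psi_sign; rewrite // card_imset //;
  apply: perm_inj.
Qed.

(** [psi] has only two values, [al] when the point lies in the set and [be] when not, and the zero
    sum over points ties them together. If [p] is in [B], every term is [be]; if not, exactly [m] of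
    the sets [D] contain [p]. *)
Lemma psi_kneser_generic p (B : {set T}) e : #|B| = k ->
    (k != 1%N) || (#|T| != 3%N) ->
  \sum_(D : {set T} | (#|D| == k) && [disjoint D & B]) psi p D e
    = - 'C(#|T| - k - 1, k - 1)%:R * psi p B e.
Proof.
move=> cB not31; set m := 'C(_, _).
have cC : #|~: B| = (#|T| - k)%N by rewrite cardsCs setCK cB.
have /card_gt0P[p1 Bp1] : (0 < #|B|)%N by rewrite cB.
have /card_gt0P[p0] : (0 < #|~: B|)%N by rewrite cC; lia.
rewrite inE => nBp0.
pose al := psi p1 B e; pose be := psi p0 B e.
have psiE q (D : {set T}) : #|D| = k -> psi q D e = be + (al - be) *+ (q \in D).
  move=> cD; have [Dq|nDq] := boolP (q \in D).
    by rewrite mulr1n addrC subrK; apply: psi_const; rewrite ?Dq ?Bp1.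
  by rewrite mulr0n addr0; apply: psi_const; rewrite ?(negPf nDq) ?(negPf nBp0).
have rel : al *+ k + be *+ (#|T| - k) = 0.
  rewrite -(psi_sum e cB) (bigID (mem B)) /=; congr (_ + _).
    rewrite -cB -sumr_const; apply: eq_bigr => q Bq.
    by apply: psi_const; rewrite ?Bq.
  rewrite -cC -sumr_const; apply: eq_big => [q|q]; rewrite inE // => nBq.
  by apply: psi_const; rewrite ?(negPf nBq) ?(negPf nBp0).
have rel2 : be *+ 'C(#|T| - k, k) = - (al *+ m).
  have k_neq0 : (k%:R : R) != 0 by rewrite pnatr_eq0 -lt0n.
  apply: (mulfI k_neq0); rewrite mulrN !mulr_natl -mulrnA mulnC.
  (* The absorption identity for binomials turns [rel], once multiplied by [m], into [rel2] times
     [k]. *)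
  have -> : (k * 'C(#|T| - k, k) = (#|T| - k) * m)%N.
    by have := mul_bin_diag (#|T| - k) k.-1; rewrite prednK // -!subn1.
  by rewrite mulrnA -(addr0_eq rel) mulNrn -!mulrnA mulnC.
have N0 : #|[set D : {set T} | (#|D| == k) && [disjoint D & B]]|
    = 'C(#|T| - k, k).
  have := @card_draws_between T k set0 B; rewrite cards0 !subn0 cB => <- //.
    by apply: eq_card => D; rewrite !inE sub0set.
  by rewrite disjoints_subset sub0set.
rewrite (eq_bigr (fun D : {set T} => be + if p \in D then al - be else 0));
  last first.
  by move=> D /andP[/eqP cD _]; rewrite psiE // mulrb.
rewrite big_split /= sumr_const -[X in _ *+ X]cardsE N0 rel2 psiE //.
rewrite -big_mkcondr /=.
have [Bp|nBp] := boolP (p \in B).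
  rewrite [X in _ + X]big1 ?addr0; last first.
    by move=> D /andP[/andP[_ dDB] Dp]; rewrite (disjointFr dDB Dp) in Bp.
  by rewrite mulr1n addrC subrK mulNr mulr_natl.
rewrite mulr0n addr0 sumr_const.
have dpB : [disjoint [set p] & B] by rewrite disjoints1.
have := card_draws_between (k := k) dpB; rewrite cards1 cB => /(_ k_gt0) N1.
have -> : #|[pred D : {set T} | ((#|D| == k) && [disjoint D & B]) && (p \in
  D)]| = m.
  by rewrite /m -N1; apply: eq_card => D; rewrite !inE sub1set andbAC andbA.
by rewrite mulNr mulr_natl mulrnBl addrA addNr sub0r.
Qed.

(* Here each k-set has a stabilizer without odd permutations, and psi p B e may
   depend on e; a 3-cycle turns the sum over D into a sum over points. *)
Lemma psi_kneser_31 p (B : {set T}) e : #|B| = k -> k = 1%N -> #|T| = 3%N ->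
  \sum_(D : {set T} | (#|D| == k) && [disjoint D & B]) psi p D e = - psi p B e.
Proof.
(* Distinct singletons are disjoint, so the claim is that [psi p D e] sums to 0 over all singletons
   [D]. *)
move=> cB k1 T3; apply/eqP; rewrite -addr_eq0 addrC; apply/eqP.
transitivity (\sum_(D : {set T} | #|D| == k) psi p D e).
  rewrite [RHS](bigD1 B) /= ?cB //; congr (_ + _); apply: eq_bigl => D.
  apply: andb_id2l; rewrite k1 => /cards1P[d ->].
  move: cB; rewrite k1 => /eqP/cards1P[b ->].
  by rewrite disjoints1 inE (inj_eq set1_inj).
have /cards2P[y [z [neq_yz def_yz]]] : #|[set~ p]| == 2%N.
  by have := cardsC1 p; rewrite T3 => ->.
have : p \notin [set y; z] by rewrite -def_yz !inE eqxx.
rewrite !inE negb_or => /andP[neq_py neq_pz].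
have sumT (F : T -> R) : \sum_q F q = F p + (F y + F z).
  rewrite (bigD1 p) //=; congr (_ + _).
  rewrite (eq_bigl (mem [set y; z])) => [|q]; last by rewrite -def_yz !inE.
  by rewrite big_setU1 ?inE //= big_set1.
have -> : \sum_(D : {set T} | #|D| == k) psi p D e = \sum_d psi p [set d] e.
  rewrite -[RHS](big_imset (fun D => psi p D e)) /=; last exact: in2W set1_inj.
  apply: eq_bigl => D; rewrite k1; apply/cards1P/imsetP=> [[d ->]|[d _ ->]];
    by exists d.
rewrite sumT -(psi_sum (B := [set p]) e) ?cards1 // sumT.
(* The even cycle p -> z -> y -> p takes [psi p [set y]] to [psi z [set p]], and its square takes
   [psi p [set z]] to [psi y [set p]]; what results is the zero sum at [[set p]]. *)
pose c := (tperm p y * tperm y z)%g.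
have odd_c : odd_perm c = false by rewrite odd_permM !odd_tperm neq_py neq_yz.
have psic q d : psi q [set d] e = psi (c q) [set c d] e.
  by have := psi_inv c q e (B := [set d]);
    rewrite cards1 imset_set1 odd_c addbF => ->.
have cp : c p = z by rewrite permM tpermL tpermL.
have cy : c y = p by rewrite permM tpermR tpermD // eq_sym.
have cz : c z = y by rewrite permM (tpermD neq_pz neq_yz) tpermR.
by rewrite (psic p y) (psic p z) cp cy cz (psic z y) cz cy; congr (_ + _);
  rewrite addrC.
Qed.

Lemma psi_kneser p (B : {set T}) e : #|B| = k ->
  \sum_(D : {set T} | (#|D| == k) && [disjoint D & B]) psi p D e
    = - 'C(#|T| - k - 1, k - 1)%:R * psi p B e.
Proof.
move=> cB; have [not31|] := boolP ((k != 1%N) || (#|T| != 3%N)).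
  exact: psi_kneser_generic.
rewrite negb_or !negbK => /andP[/eqP k1 /eqP T3].
by rewrite psi_kneser_31 // T3 k1 mulN1r.
Qed.

End SignedSubsets.

(** * Isomorphisms of submodules as matrices on the ambient modules *)

Section Intertwiners.
Local Open Scope ring_scope.
Variables (F : fieldType) (gT : finGroupType) (G : {group gT}) (n1 n2 : nat).
Variables (rG1 : mx_representation F G n1) (rG2 : mx_representation F G n2).

(** [Phi] takes coordinates in [U], applies the isomorphism and includes [V]. As [in_submod] is
    linear on the whole space, [Phi] is a full matrix, but equivariance is claimed only on [U]. *)
Lemma rsim_intertwiner (U : 'M_n1) (V : 'M_n2)
    (modU : mxmodule rG1 U) (modV : mxmodule rG2 V) :
  mx_rsim (submod_repr modU) (submod_repr modV) ->
  exists2 Phi : 'M[F]_(n1, n2),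
    (V <= U *m Phi)%MS
    & forall (v : 'rV_n1) g, (v <= U)%MS -> g \in G ->
      v *m rG1 g *m Phi = v *m Phi *m rG2 g.
Proof.
case=> B eqr freeB homB.
have assoc m (X : 'M_(m, n1)) P Q : X *m (P *m B *m Q) = X *m P *m B *m Q.
  by rewrite !mulmxA.
exists (in_submod U 1%:M *m B *m val_submod 1%:M).
  (* Both submodules have the same rank, so the row-free [B] is also row-full. *)
  have /row_fullP[D DB] : row_full B by apply/eqP; rewrite (eqP freeB).
  have /submxP[E valD] : (val_submod D <= U)%MS by apply: val_submodP.
  apply: submx_trans (_ : (V <= val_submod 1%:M)%MS) _;
    first by rewrite val_submod1.
  apply/submxP; exists E; rewrite mulmxA -valD assoc -in_submodE val_submodK DB.
  by rewrite mul1mx.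
move=> v g sv Gg; rewrite !assoc -!in_submodE -!val_submodE.
by rewrite (in_submodJ modU) // -mulmxA homB // mulmxA val_submodJ.
Qed.

(** The submodule is the image of [U] under [Phi]; [B] below is [Phi] restricted to [U], in the
    coordinates of [U] and [V]. *)
Lemma intertwiner_rsim (U : 'M_n1) (modU : mxmodule rG1 U)
    (Phi : 'M[F]_(n1, n2)) :
  {in G, forall g, rG1 g *m Phi = Phi *m rG2 g} ->
  (forall v : 'rV_n1, (v <= U)%MS -> v *m Phi = 0 -> v = 0) ->
  exists (V : 'M_n2) (modV : mxmodule rG2 V),
    mx_rsim (submod_repr modV) (submod_repr modU).
Proof.
move=> homPhi injPhi; pose V := <<U *m Phi>>%MS.
have modV : mxmodule rG2 V.
  apply/mxmoduleP=> g Gg; rewrite (eqmxMr _ (genmxE _)) genmxE -mulmxA -homPhi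
    //.
  by rewrite mulmxA submxMr // (mxmoduleP modU).
exists V, modV; apply: mx_rsim_sym.
pose B := in_submod V (val_submod (1%:M : 'M_(\rank U)) *m Phi).
have valB : val_submod B = val_submod 1%:M *m Phi.
  by rewrite in_submodK // genmxE submxMr // val_submodP.
have freeB : row_free B.
  rewrite -kermx_eq0; apply/rowV0P=> w /sub_kermxP wB0.
  apply/eqP; rewrite -val_submod_eq0; apply/eqP.
  apply: injPhi; first exact: val_submodP.
  by rewrite val_submodE -mulmxA -valB val_submodE mulmxA wB0 mul0mx.
have eqr : \rank U = \rank V.
  rewrite /V genmxE; apply/esym/mxrank_injP.
  apply/rowV0P=> v; rewrite sub_capmx => /andP[vU /sub_kermxP].
  exact: injPhi.
exists B => // g Gg; apply: val_submod_inj.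
rewrite val_submodJ // valB -[RHS]mulmxA -homPhi // [RHS]mulmxA.
rewrite -(val_submodJ modU 1%:M Gg) mul1mx val_submodE -mulmxA -val_submodE
  valB.
by rewrite mulmxA -val_submodE.
Qed.

End Intertwiners.

(** * Coordinates indexed by coset representatives *)

Section CosetCoordinates.
Local Open Scope ring_scope.
Variables (gT : finGroupType) (H : {group gT}).
Local Notation N := #|rcosets H [set: gT]|.

Lemma mem_rcosetsT x : (H :* x)%g \in rcosets H [set: gT].
Proof. by apply/rcosetsP; exists x; rewrite ?inE. Qed.

(** The coset of 1 only provides the inhabitant that [enum_rank_in] asks for. *)
Definition coset_index x : 'I_N := enum_rank_in (mem_rcosetsT 1%g) (H :* x)%g.

Lemma coset_indexE x : enum_val (coset_index x) = (H :* x)%g.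
Proof. by rewrite enum_rankK_in // mem_rcosetsT. Qed.

Lemma coset_index_surj i : exists x, i = coset_index x.
Proof.
have /rcosetsP[x _ def_x] := enum_valP i; exists x; apply: enum_val_inj.
by rewrite coset_indexE.
Qed.

Lemma coset_index_eq x y :
  (coset_index x == coset_index y) = ((x * y^-1)%g \in H).
Proof.
rewrite -(inj_eq enum_val_inj) !coset_indexE -mem_rcoset.
by apply/eqP/idP => [<-|/rcoset_eqP//]; rewrite rcoset_refl.
Qed.

Lemma mul_coset_mx (C : fieldType) (v : 'rV[C]_N) g x :
  (v *m coset_mx C [set: gT] H g) 0 (coset_index (x * g)%g)
    = v 0 (coset_index x).
Proof.
rewrite mxE (bigD1 (coset_index x)) //= mxE !coset_indexE -rcosetM eqxx mulr1.
rewrite big1 ?addr0 // => i neq_i; rewrite mxE coset_indexE.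
case: eqP => [eqi|_]; last by rewrite mulr0.
case/eqP: neq_i; apply: enum_val_inj; rewrite coset_indexE.
by apply: (can_inj (rcosetK g)); rewrite eqi rcosetM.
Qed.

Lemma coset_vecE (C : fieldType) x :
  coset_vec C [set: gT] H (H :* x)%g = delta_mx 0 (coset_index x).
Proof.
by apply/rowP=> j; rewrite !mxE -(inj_eq enum_val_inj) coset_indexE.
Qed.

End CosetCoordinates.

(** * The Specht module of shape [n-1,1] *)

Section StandardSpecht.
Local Open Scope ring_scope.
Variables (C : fieldType) (m : nat).
Local Notation n := m.+2.
Local Notation la := [:: m.+1; 1%N].
Local Notation rS := (row_stab n la).

Lemma hook_index (i : 'I_n) : reshape_index la i = (i == ord_max).
Proof.
rewrite /reshape_index /= -val_eqE /=; have := ltn_ord i.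
rewrite subn_eq0; case: (ltnP i m.+1) => le_im ltin;
  first by rewrite /= ltn_eqF.
have -> : nat_of_ord i = m.+1 by apply/eqP; rewrite eqn_leq le_im andbT -ltnS.
by rewrite eqxx subSnn subnn.
Qed.

Lemma hook_offset (i : 'I_n) :
  reshape_offset la i = if i == ord_max then 0%N else i.
Proof.
rewrite /reshape_offset hook_index; case: eqP => [->|_] /=;
  last by rewrite subn0.
by rewrite addn0 subnn.
Qed.

Lemma hook_row_stab (s : 'S_n) : (s \in rS) = (s ord_max == ord_max).
Proof.
apply/bigcapP/eqP => [stab_s|fix_s r _].
  have /astabsP/(_ ord_max) := stab_s (@Ordinal 2 1 isT) isT.
  by rewrite !inE !hook_index eqxx /= /aperm; case: (s ord_max =P ord_max).
rewrite /=; apply/astabsP=> i; rewrite !inE !hook_index /= /aperm.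
by rewrite -[in s i == _]fix_s (inj_eq perm_inj).
Qed.

(** The first column holds [ord0] and [ord_max]; each other column has at most one entry. *)
Lemma hook_col_stab (s : 'S_n) :
  (s \in col_stab n la) = (s \in [set 1%g; tperm ord0 ord_max]).
Proof.
have neq0 : (ord0 : 'I_n) != ord_max by [].
apply/bigcapP/set2P => [stab_s|].
  have off i : reshape_offset la (s i) = reshape_offset la i.
    have lti : (reshape_offset la i < n)%N.
      by rewrite hook_offset; case: eqP.
    have /astabsP/(_ i) := stab_s (Ordinal lti) isT.
    by rewrite !inE /= eqxx => /eqP.
  have fix_s i : i != ord0 -> i != ord_max -> s i = i.
    move=> nz nmax; have := off i; rewrite !hook_offset (negPf nmax).
    case: eqP => [_ /esym i0|_ eqi]; last exact: val_inj.
    by case/eqP: nz; apply: val_inj.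
  have s0 : (s ord0 == ord0) || (s ord0 == ord_max).
    have := off ord0; rewrite !hook_offset (negPf neq0).
    by case: eqP => [_|_ /= s0]; rewrite ?orbT // -val_eqE /= s0.
  have smax : (s ord_max == ord0) || (s ord_max == ord_max).
    have := off ord_max; rewrite !hook_offset eqxx.
    by case: eqP => [_|_ /= smax]; rewrite ?orbT // -val_eqE /= smax.
  case/orP: s0 => /eqP s0; [left | right]; apply/permP=> i; rewrite ?perm1.
    case/orP: smax => /eqP smax.
      by have := neq0; rewrite -(inj_eq (@perm_inj _ s)) s0 smax eqxx.
    have [->//|nz] := eqVneq i ord0; have [->//|nmax] := eqVneq i ord_max.
    exact: fix_s.
  case/orP: smax => /eqP smax; last first.
    by have := neq0; rewrite -(inj_eq (@perm_inj _ s)) s0 smax eqxx.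
  by case: tpermP => [->|->|/eqP nz /eqP nmax] //; apply: fix_s.
move=> def_s c _ /=; apply/astabsP=> i; rewrite !inE !hook_offset /= /aperm.
case: def_s => ->; rewrite ?perm1 //.
case: tpermP => [->|->|//]; first by rewrite eqxx.
by rewrite eqxx.
Qed.

(** A tabloid of this shape is determined by the entry [p] of its second row; [tperm ord_max p] is
    one tableau with that entry. *)
Definition tabloid (p : 'I_n) : 'rV[C]_#|rcosets rS [set: 'S_n]| :=
  coset_vec C [set: 'S_n] rS (rS :* tperm ord_max p).

Lemma tabloidE (s : 'S_n) :
  coset_vec C [set: 'S_n] rS (rS :* s) = tabloid (s ord_max).
Proof.
rewrite /tabloid; congr (coset_vec _ _ _ _); apply/rcoset_eqP.
by rewrite mem_rcoset hook_row_stab permM tpermV tpermR.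
Qed.

Lemma tabloid_mul p g :
  tabloid p *m coset_mx C [set: 'S_n] rS g = tabloid (g p).
Proof.
by rewrite coset_vec_mx ?mem_rcosetsT // -rcosetM tabloidE permM tpermL.
Qed.

Lemma polytabloidE s :
  polytabloid C la s = tabloid (s ord_max) - tabloid (s ord0).
Proof.
have neq0 : (ord0 : 'I_n) != ord_max by [].
have neq1 : 1%g != tperm ord0 ord_max :> 'S_n.
  by apply/eqP=> /permP/(_ ord0)/eqP; rewrite perm1 tpermL (negPf neq0).
rewrite /polytabloid (eq_bigl _ _ hook_col_stab) big_setU1 ?inE //= big_set1.
rewrite odd_perm1 odd_tperm neq0 expr0 scale1r expr1 scaleN1r !tabloidE.
by rewrite !permM perm1 tpermR.
Qed.

Lemma tabloid_sub_specht p q : (tabloid p - tabloid q <= specht_mx C n la)%MS.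
Proof.
have [->|neq_pq] := eqVneq p q; first by rewrite subrr sub0mx.
have neq0 : (ord0 : 'I_n) != ord_max by [].
pose s0 : 'S_n := tperm ord_max p; pose r := s0 ord0.
have neq_rp : r != p.
  by rewrite /r -(tpermL ord_max p : s0 ord_max = p) (inj_eq perm_inj).
(* [s0] sends [ord_max] to [p]; the second factor moves the image of [ord0] to [q] and fixes [p],
   which differs from [r] and [q]. *)
pose s := (s0 * tperm r q)%g.
have -> : tabloid p - tabloid q = polytabloid C la s.
  rewrite polytabloidE !permM -/r tpermL; congr (tabloid _ - _).
  by rewrite tpermL tpermD // eq_sym.
by apply: (sumsmx_sup s) => //; rewrite genmxE.
Qed.

(** This makes the scalar on a Specht summand a genuine eigenvalue. *)
Lemma specht_neq0 : specht_mx C n la != 0.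
Proof.
apply/eqP=> S0; have := tabloid_sub_specht ord_max ord0.
rewrite S0 submx0 subr_eq0 /tabloid !coset_vecE => /eqP/rowP/(_ (coset_index rS
  (tperm ord_max ord_max))).
rewrite !mxE !eqxx /= coset_index_eq hook_row_stab permM tpermV !tperm1 perm1.
by rewrite tpermL /= => /eqP; rewrite oner_eq0.
Qed.

End StandardSpecht.

(** * Cosets of H as signed k-sets *)

Section EvenYoung.
Local Open Scope ring_scope.
Variables n k : nat.
Local Notation H := (even_young n k).
Local Notation F := (first_points n k).

Lemma even_young_coset_eq (x y : 'S_n) :
  (coset_index H x == coset_index H y)
    = (x @: F == y @: F) && (odd_perm x == odd_perm y).
Proof.
rewrite coset_index_eq inE Alt_even odd_permM odd_permV.
congr (_ && _); last by case: (odd_perm x) (odd_perm y) => [] [].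
have imM (s t : 'S_n) (A : {set 'I_n}) : (s * t)%g @: A = t @: (s @: A).
  by rewrite -imset_comp; apply: eq_imset => z; rewrite permM.
apply/idP/eqP => [Nxy|eqxy].
  have fixF : (x * y^-1)%g @: F = F.
    by rewrite -[RHS](astabs_setact Nxy) /setact; apply: eq_imset.
  by rewrite -[x in LHS](mulgKV y) imM fixF.
have fixF : (x * y^-1)%g @: F = F.
  rewrite imM eqxy -imM mulgV -[RHS]imset_id.
  by apply: eq_imset => z; rewrite perm1.
apply/astabsP=> z; rewrite /= /aperm.
by have := mem_imset F z (@perm_inj _ (x * y^-1)%g); rewrite fixF.
Qed.

Lemma repr_even_young (x : 'S_n) :
  (repr (H :* x)%g @: F = x @: F) * (odd_perm (repr (H :* x)%g) = odd_perm x).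
Proof.
have : coset_index H (repr (H :* x)%g) == coset_index H x.
  by rewrite coset_index_eq -mem_rcoset mem_repr_rcoset.
by rewrite even_young_coset_eq => /andP[/eqP-> /eqP->].
Qed.

End EvenYoung.

(** * Embedding the Specht module by point-coset incidence *)

Section Incidence.
Local Open Scope ring_scope.
Variables (C : numFieldType) (m k : nat).
Local Notation n := m.+2.
Local Notation la := [:: m.+1; 1%N].
Local Notation rS := (row_stab n la).
Local Notation H := (even_young n k).
Local Notation F := (first_points n k).
Local Notation G := [set: 'S_n].

Definition tabloid_point (i : 'I_#|rcosets rS G|) : 'I_n :=
  (repr (enum_val i) : 'S_n) ord_max.

Definition incidence_mx : 'M[C]_(#|rcosets rS G|, #|rcosets H G|) :=
  \matrix_(i, j) (tabloid_point i \in (repr (enum_val j) : 'S_n) @: F)%:R.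

Lemma tabloid_point_index x : tabloid_point (coset_index rS x) = x ord_max.
Proof.
rewrite /tabloid_point coset_indexE.
have := mem_repr_rcoset rS x; rewrite mem_rcoset hook_row_stab permM.
by rewrite -{2}(permK x ord_max) (inj_eq perm_inj) => /eqP.
Qed.

Lemma incidence_mxE x y :
  incidence_mx (coset_index rS x) (coset_index H y) = (x ord_max \in y @: F)%:R.
Proof.
by rewrite mxE tabloid_point_index coset_indexE repr_even_young.
Qed.

(** Applying [g] to both a point and a k-set preserves membership. *)
Lemma incidence_mx_hom g :
  coset_mx C G rS g *m incidence_mx = incidence_mx *m coset_mx C G H g.
Proof.
apply/matrixP=> i j; have [x ->] := coset_index_surj i.
have [y ->] := coset_index_surj j; rewrite -[y](mulgKV g).
have := mul_coset_mx (row (coset_index rS x) incidence_mx) g (y * g^-1)%g.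
rewrite -row_mul mxE [RHS]mxE incidence_mxE => ->.
rewrite mxE (bigD1 (coset_index rS (x * g)%g)) //= mxE !coset_indexE rcosetM
  eqxx mul1r.
rewrite [X in _ + X]big1 => [|l neq_l]; last first.
  rewrite mxE coset_indexE -rcosetM; case: eqP => [eql|]; last by rewrite mul0r.
  by case/eqP: neq_l; apply: enum_val_inj; rewrite coset_indexE.
rewrite addr0 incidence_mxE permM; congr (_ %:R).
have -> : (y * g^-1 * g)%g @: F = g @: ((y * g^-1)%g @: F).
  by rewrite -imset_comp; apply: eq_imset => z; rewrite permM.
by rewrite mem_imset //; apply: perm_inj.
Qed.

Lemma tabloid_index_bij :
  bijective (fun p : 'I_n => coset_index rS (tperm ord_max p)).
Proof.
exists tabloid_point => [p|i]; first by rewrite tabloid_point_index tpermL.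
have [x ->] := coset_index_surj i; apply/eqP.
by rewrite tabloid_point_index coset_index_eq hook_row_stab permM tpermL permK.
Qed.

Lemma specht_sum0 (v : 'rV_#|rcosets rS G|) :
  (v <= specht_mx C n la)%MS -> \sum_i v 0 i = 0.
Proof.
move=> sv; have /sub_kermxP :
    (v <= kermx (const_mx 1 : 'cV[C]_#|rcosets rS G|))%MS.
  apply: submx_trans sv _; apply/sumsmx_subP=> s _; rewrite genmxE.
  apply/sub_kermxP; rewrite polytabloidE mulmxBl /tabloid !coset_vecE.
  by rewrite -!rowE; apply/eqP; rewrite subr_eq0; apply/eqP/rowP=> j;
    rewrite !mxE.
move/matrixP/(_ 0 0); rewrite !mxE => sum0; rewrite -[RHS]sum0.
by apply: eq_bigr => i _; rewrite mxE mulr1.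
Qed.

(** A vector in the kernel is a function [c] on points whose sum over every k-set is 0. Exchanging
    one point of a k-set shows that [c] is constant, and the zero total on the Specht module then
    kills it in characteristic 0. *)
Lemma incidence_mx_inj (v : 'rV_#|rcosets rS G|) : (0 < k < n)%N ->
  (v <= specht_mx C n la)%MS -> v *m incidence_mx = 0 -> v = 0.
Proof.
case/andP=> k_gt0 lt_kn sv vW0.
pose c p := v 0 (coset_index rS (tperm ord_max p)).
have sumF (y : 'S_n) : \sum_(q in F) c (y q) = 0.
  have /rowP/(_ (coset_index H y)) := vW0; rewrite !mxE => vW0y.
  rewrite -[RHS]vW0y.
  rewrite (reindex _ (onW_bij _ tabloid_index_bij)) /=.
  rewrite [RHS](reindex_inj (@perm_inj _ y)) big_mkcond /=.
  apply: eq_bigr => q _; rewrite incidence_mxE tpermL mem_imset;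
    last exact: perm_inj.
  by case: ifP; rewrite ?mulr1 ?mulr0.
have F0 : ord0 \in F by rewrite inE.
have nFmax : ord_max \notin F by rewrite inE /= -leqNgt -ltnS.
(* The k-sets y @: F and (tperm ord0 ord_max * y) @: F differ in one point. *)
have c_eq (y : 'S_n) : c (y ord0) = c (y ord_max).
  have := etrans (sumF y) (esym (sumF (tperm ord0 ord_max * y)%g)).
  rewrite (bigD1 ord0) // [RHS](bigD1 ord0) //= permM tpermL.
  rewrite [X in _ = _ + X](eq_bigr (fun q => c (y q))); first by move/addIr.
  move=> q /andP[Fq nz]; rewrite permM tpermD // eq_sym //.
  by apply: contraTneq Fq => ->.
have c0 p : c p = c ord0.
  have [->//|nz] := eqVneq p ord0.
  by have := c_eq (tperm ord_max p); rewrite tpermL tpermD // => ->.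
have c00 : c ord0 = 0.
  have := specht_sum0 sv.
  rewrite (reindex _ (onW_bij _ tabloid_index_bij)) /= (eq_bigr (fun=> c ord0)).
    by rewrite sumr_const card_ord => /eqP; rewrite mulrn_eq0 => /eqP.
  by move=> p _; apply: c0.
apply/rowP=> i; have [g _ gK] := tabloid_index_bij.
by rewrite -(gK i) mxE -/(c _) c0.
Qed.

Lemma specht_submodule_exists : (0 < k < n)%N ->
  exists (U : 'M[C]_#|rcosets H G|) (modU : mxmodule (coset_repr C [set:
    'S_n]%G H) U),
    mx_rsim (submod_repr modU) (specht_repr C n la).
Proof.
move=> kn; apply: (@intertwiner_rsim _ _ _ _ _ _ _ _ _ incidence_mx) => [g _|v].
  exact: incidence_mx_hom.
exact: incidence_mx_inj.
Qed.

End Incidence.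

(** * The adjacency matrix of K^+(n,k) on signed k-sets *)

Lemma card_first_points n k : k <= n -> #|first_points n k| = k.
Proof. by move=> le_kn; rewrite cardsE -sum1_card (big_ord_narrow le_kn)
  sum1_card card_ord. Qed.

Section KneserPlus.
Local Open Scope ring_scope.
Variables (C : numFieldType) (n k : nat).
Hypotheses (k_gt0 : (0 < k)%N) (le_2k : (k + k <= n)%N) (n_gt2 : (2 < n)%N).
Local Notation H := (even_young n k).
Local Notation F := (first_points n k).
Local Notation G := [set: 'S_n].
Local Notation N := #|rcosets H G|.
Local Notation A := (kneser_plus_mx n k C).
Implicit Types (v : 'rV[C]_N) (B D : {set 'I_n}).

Lemma card_imset_first_points (x : 'S_n) : #|x @: F| = k.
Proof.
by rewrite card_imset ?card_first_points //; [lia | apply: perm_inj].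
Qed.

Lemma exists_signed_perm B e : #|B| = k ->
  exists2 x : 'S_n, x @: F = B & odd_perm x = e.
Proof.
move=> cB; have [|x xF] := @exists_perm_imset _ F B;
  first by rewrite cB card_first_points //; lia.
have [<-|neq_e] := eqVneq (odd_perm x) e; first by exists x.
(* Since [n > 2], two points lie outside [F]; swapping them first changes the sign of [x] but not
   [x @: F]. *)
have : (1 < #|~: F|)%N.
  rewrite cardsCs setCK card_ord card_first_points; lia.
case/card_gt1P=> a [b []]; rewrite !in_setC => nFa nFb neq_ab.
exists (tperm a b * x)%g; last first.
  by rewrite odd_permM odd_tperm neq_ab; case: (odd_perm x) e neq_e => [] [].
rewrite -xF -[in RHS](@tperm_imset _ a b F) ?(negPf nFa) ?(negPf nFb) //.
by rewrite -imset_comp; apply: eq_imset => z; rewrite permM.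
Qed.

Definition coset_key (i : 'I_N) : {set 'I_n} * bool :=
  ((repr (enum_val i) : 'S_n) @: F, odd_perm (repr (enum_val i) : 'S_n)).

Lemma coset_keyE (x : 'S_n) :
  coset_key (coset_index H x) = (x @: F, odd_perm x).
Proof. by rewrite /coset_key coset_indexE !repr_even_young. Qed.

Lemma coset_key_inj : injective coset_key.
Proof.
move=> i j; have [x ->] := coset_index_surj i;
  have [y ->] := coset_index_surj j.
rewrite !coset_keyE => -[eqF eqe]; apply/eqP.
by rewrite even_young_coset_eq eqF eqe !eqxx.
Qed.

Lemma sum_coset_key (f : {set 'I_n} * bool -> C) :
  \sum_i f (coset_key i) = \sum_(c : {set 'I_n} * bool | #|c.1| == k) f c.
Proof.
rewrite -(big_imset f (in2W coset_key_inj)); apply: eq_bigl => -[B e] /=.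
apply/imsetP/eqP => [[i _]|/(exists_signed_perm e)[x <- <-]].
  have [x ->] := coset_index_surj i; rewrite coset_keyE => -[-> _].
  exact: card_imset_first_points.
by exists (coset_index H x); rewrite ?coset_keyE.
Qed.

(** Keys are injective, so the sum has at most one term: it is the value of [v] at the coset with
    key [(B, e)], or 0 if there is none. *)
Definition signed_fun v B e : C := \sum_(i | coset_key i == (B, e)) v 0 i.

Lemma signed_funE v (x : 'S_n) :
  signed_fun v (x @: F) (odd_perm x) = v 0 (coset_index H x).
Proof.
rewrite /signed_fun -coset_keyE (big_pred1 (coset_index H x)) // => i.
exact: inj_eq coset_key_inj _ _.
Qed.

Lemma kneser_plus_mulE v (x : 'S_n) :
  (v *m A) 0 (coset_index H x)
    = \sum_(D : {set 'I_n} | (#|D| == k) && [disjoint D & x @: F])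
         signed_fun v D (odd_perm x).
Proof.
pose f (c : {set 'I_n} * bool) :=
  if [disjoint c.1 & x @: F] && (c.2 == odd_perm x)
  then signed_fun v c.1 c.2 else 0.
transitivity (\sum_i f (coset_key i)).
  rewrite mxE; apply: eq_bigr => i _; have [y ->] := coset_index_surj i.
  rewrite /f coset_keyE signed_funE mxE !coset_indexE kneser_plusE.
  by case: ifP; rewrite ?mulr1 ?mulr0.
rewrite sum_coset_key -big_mkcondr /=.
rewrite (eq_bigl (fun c : {set 'I_n} * bool =>
  ((#|c.1| == k) && [disjoint c.1 & x @: F]) && (c.2 == odd_perm x)));
    last first.
  by move=> c; rewrite andbA.
rewrite -(pair_big (fun D : {set 'I_n} => (#|D| == k) && [disjoint D & x @: F])
  (fun e => e == odd_perm x) (signed_fun v)) /=.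
by apply: eq_bigr => D _; rewrite big_pred1_eq.
Qed.

(** Read through keys, the family [h] satisfies the two hypotheses on [psi], and [A] becomes the
    disjointness sum within one sign. *)
Lemma point_family_eigen (h : 'I_n -> 'rV[C]_N) p :
    (forall g q, h q *m coset_mx C G H g = h (g q)) -> \sum_q h q = 0 ->
  h p *m A = - 'C(n - k - 1, k - 1)%:R *: h p.
Proof.
move=> hM sum0; apply/rowP=> i; have [x ->] := coset_index_surj i.
rewrite kneser_plus_mulE mxE -signed_funE -[X in 'C(X - k - 1, _)](card_ord n).
apply: (psi_kneser (psi := fun q => signed_fun (h q))); rewrite ?card_ord //.
- move=> g q B e /(exists_signed_perm e)[y <- <-].
  rewrite -odd_permM.
  have -> : g @: (y @: F) = (y * g)%g @: F.
    by rewrite -imset_comp; apply: eq_imset => z; rewrite permM.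
  by rewrite !signed_funE -hM mul_coset_mx.
- move=> B e /(exists_signed_perm e)[y <- <-].
  rewrite (eq_bigr (fun q => h q 0 (coset_index H y))) => [|q _];
    last exact: signed_funE.
  by rewrite -summxE sum0 mxE.
exact: card_imset_first_points.
Qed.

Lemma kneser_plus_eigenvalue_ge b : eigenvalue A b ->
  - 'C(n - k - 1, k - 1)%:R <= b.
Proof.
case/eigenvalueP=> v vA /rV0Pn[i]; have [x ->] := coset_index_surj i => vx.
(* Fixing the sign of a coset where [v] is nonzero gives a nonzero eigenfunction on one copy of the
   Kneser graph. *)
have [|||j le_jk ->] := @kneser_eigenvalue _ k _ (fun D => signed_fun v D
  (odd_perm x)) b (x @: F).
- exact: card_imset_first_points.
- by rewrite signed_funE.
- move=> B /(exists_signed_perm (odd_perm x))[y <- <-].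
  by rewrite -kneser_plus_mulE vA mxE signed_funE.
by rewrite card_ord kneser_eigenvalue_ge.
Qed.

End KneserPlus.

(** * A family of vectors permuted by G that sums to 0 *)

Section PointFamily.
Local Open Scope ring_scope.
Variables (C : fieldType) (m : nat).
Local Notation n := m.+2.
Local Notation la := [:: m.+1; 1%N].
Local Notation rS := (row_stab n la).

(** This is n e_p - sum_q e_q, written as a sum of differences so that it visibly lies in the Specht
    module. *)
Definition centered_tabloid (p : 'I_n) := \sum_q (tabloid C p - tabloid C q).

Lemma centered_tabloid_specht p : (centered_tabloid p <= specht_mx C n la)%MS.
Proof. by apply: summx_sub => q _; apply: tabloid_sub_specht. Qed.

Lemma centered_tabloid_mul p g :
  centered_tabloid p *m coset_mx C [set: 'S_n] rS g = centered_tabloid (g p).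
Proof.
rewrite mulmx_suml [RHS](reindex_inj (@perm_inj _ g)) /=; apply: eq_bigr => q _.
by rewrite mulmxBl !tabloid_mul.
Qed.

Lemma sum_centered_tabloid : \sum_p centered_tabloid p = 0.
Proof.
apply/eqP; rewrite /centered_tabloid (eq_bigr (fun p =>
  \sum_(q < n) tabloid C p - \sum_(q < n) tabloid C q)) => [|p _];
    last by rewrite sumrB.
by rewrite sumrB exchange_big subrr.
Qed.

Lemma centered_tabloidB p q :
  centered_tabloid p - centered_tabloid q = (tabloid C p - tabloid C q) *+ n.
Proof.
rewrite -sumrB (eq_bigr (fun=> tabloid C p - tabloid C q)) ?sumr_const
  ?card_ord //.
by move=> r _; rewrite opprB addrA subrK.
Qed.

End PointFamily.

(** * The scalar on Specht summands *)

Section SpechtSummands.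
Local Open Scope ring_scope.
Variables (C : numClosedFieldType) (m k : nat).
Local Notation n := m.+2.
Local Notation la := [:: m.+1; 1%N].
Local Notation H := (even_young n k).
Local Notation A := (kneser_plus_mx n k C).
Local Notation G := [set: 'S_n].

Lemma specht_summand_eigen (U : 'M_#|rcosets H G|)
    (modU : mxmodule (coset_repr C [set: 'S_n]%G H) U) :
    (0 < k)%N -> (k + k <= n)%N -> (2 < n)%N ->
    mx_rsim (submod_repr modU) (specht_repr C n la) ->
  U *m A = - 'C(n - k - 1, k - 1)%:R *: U.
Proof.
move=> k_gt0 le_2k n_gt2 /mx_rsim_sym/rsim_intertwiner[Phi sU homPhi].
set th := - _.
pose h p := centered_tabloid C p *m Phi.
have hA p : h p *m A = th *: h p.
  apply: point_family_eigen => // [g q|]; last first.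
    by rewrite -mulmx_suml sum_centered_tabloid mul0mx.
  rewrite -[LHS](homPhi _ g (centered_tabloid_specht C q)) ?inE //.
  by rewrite [X in X *m _]centered_tabloid_mul.
(* [U] lies in the image of the Specht module under [Phi], so it is enough that [A - th%:M] kills
   that image. *)
suff ker : (specht_mx C n la <= kermx (Phi *m (A - th%:M)))%MS.
  have /submxP[D ->] := sU; apply/eqP; rewrite -subr_eq0 -mul_mx_scalar.
  by rewrite -mulmxBr -!mulmxA (sub_kermxP ker) mulmx0.
apply/sumsmx_subP=> s _; rewrite genmxE polytabloidE; apply/sub_kermxP.
(* Each generator times n is a difference of centered tabloids, and n is invertible. *)
have n_neq0 : n%:R != 0 :> C by rewrite pnatr_eq0.
apply: (scalerI n_neq0); rewrite scaler0 scalemxAl scaler_nat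
  -centered_tabloidB.
rewrite mulmxA mulmxBl -!/(h _) mulmxBl !mulmxBr !hA !mul_mx_scalar.
by rewrite !subrr.
Qed.

Lemma specht_summand_eigenvalue (U : 'M_#|rcosets H G|)
    (modU : mxmodule (coset_repr C [set: 'S_n]%G H) U) th :
    mx_rsim (submod_repr modU) (specht_repr C n la) -> U *m A = th *: U ->
  eigenvalue A th.
Proof.
case=> _ eqr _ _ UA; have : U != 0.
  by rewrite -mxrank_eq0 eqr mxrank_eq0 specht_neq0.
case/rowV0Pn=> v /submxP[D ->] nz; apply/eigenvalueP; exists (D *m U) => //.
by rewrite -mulmxA UA -scalemxAr.
Qed.

End SpechtSummands.

(** * The case n = 2 *)

Lemma ord2_max (i : 'I_2) : i != ord0 -> i = ord_max.
Proof. by case: i => [] [|[|]] //= lti _; apply: val_inj. Qed.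

Lemma odd_perm_S2 (x : 'S_2) : odd_perm x = (x ord0 != ord0).
Proof.
have [x0|nz] := eqVneq (x ord0) ord0.
  have x1 : x ord_max = ord_max by apply: ord2_max;
    rewrite -[X in _ != X]x0 (inj_eq perm_inj).
  suff -> : x = 1 by rewrite odd_perm1.
  by apply/permP=> i; rewrite perm1; have [->|/ord2_max->] := eqVneq i ord0.
have x0 := ord2_max nz.
have x1 : x ord_max = ord0.
  by apply/eqP/negPn/negP=> /ord2_max; rewrite -x0 => /perm_inj/eqP;
    rewrite (negPf nz).
suff -> : x = tperm ord0 ord_max by rewrite odd_tperm.
apply/permP=> i; have [->|/ord2_max->] := eqVneq i ord0;
  first by rewrite tpermL x0.
by rewrite tpermR x1.
Qed.

(** On two points the sign determines the permutation, so equal signs give equal images of the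
    nonempty [first_points 2 1], which are not disjoint. *)
Lemma kneser_plus_mx_2 (C : fieldType) : kneser_plus_mx 2 1 C = 0%R.
Proof.
apply/matrixP=> i j; rewrite !mxE.
have [x ->] := coset_index_surj i; have [y ->] := coset_index_surj j.
rewrite !coset_indexE kneser_plusE !odd_perm_S2.
case: andP => // -[dxy /eqP eqxy].
have F0 : ord0 \in first_points 2 1 by rewrite inE.
have eq0 : x ord0 = y ord0.
  have [x0|nx0] := eqVneq (x ord0) ord0; have [y0|ny0] := eqVneq (y ord0) ord0.
  - by rewrite x0 y0.
  - by move: eqxy; rewrite x0 ny0 eqxx.
  - by move: eqxy; rewrite y0 nx0 eqxx.
  by rewrite (ord2_max nx0) (ord2_max ny0).
by have := disjointFr dxy (imset_f x F0); rewrite eq0 imset_f.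
Qed.

(** * The least eigenvalue, for n = 2 and for larger n *)

Theorem theorem8p5 (C : numClosedFieldType) (n k : nat)
    (k_ge1 : (1 <= k)%N) (le_2k_n : (2 * k <= n)%N) (nk_neq : (n, k) <> (4, 2)) :
  exists theta : C,
    afforded_eigenvalue (kneser_plus_mx n k C) [:: n.-1; 1%N] theta /\
    least_eigenvalue (kneser_plus_mx n k C) theta.
Proof.
have {le_2k_n} le_2k : k + k <= n by rewrite addnn -mul2n.
case: n le_2k {nk_neq} => [|[|m]] le_2k; [lia | lia |].
have lt_kn : 0 < k < m.+2 by lia.
have [U [modU simU]] := specht_submodule_exists C lt_kn.
have [n2|n_gt2] := eqVneq m 0%N.
  (* H is the whole Young subgroup, K^+(2,1) has no edge, and theta = 0. *)
  subst m; have k1 : k = 1%N by lia.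
  subst k; exists 0%R; have UA0 := kneser_plus_mx_2 C.
  have U0 : (U *m kneser_plus_mx 2 1 C = 0 *: U)%R.
    by rewrite UA0 mulmx0 scale0r.
  split; first split; first by exists U, modU.
    by move=> V modV _; rewrite UA0 mulmx0 scale0r.
  split; first exact: specht_summand_eigenvalue simU U0.
  move=> b /eigenvalueP[v]; rewrite UA0 mulmx0 => /esym/eqP.
  by rewrite scaler_eq0 => /orP[/eqP->//|/eqP->]; rewrite eqxx.
have {}n_gt2 : 2 < m.+2 by rewrite !ltnS lt0n.
exists (- 'C(m.+2 - k - 1, k - 1)%:R)%R.
split; first split; first by exists U, modU.
  by move=> V modV simV; apply: specht_summand_eigen simV.
split.
  by apply: specht_summand_eigenvalue (simU) (specht_summand_eigen _ _ _ simU).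
by move=> b; apply: kneser_plus_eigenvalue_ge.
Qed.
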